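(* Let a world economy with $J\ge1$ countries and $n$ country-industry pairs be given, with adjacency input matrix $\mathbf{A}$, adjacency output matrix $\mathbf{B}$, final-use transition matrix $\mathbf{D}_\eta$ and value-added vector of coefficients $\boldsymbol{\delta}$, satisfying the standing assumptions in the context. (i) Let $\mathbf{M}=[m_{i\hat j}]$ be the global final demand matrix, i.e. the $n\times J$ matrix in which $m_{i\hat j}$ is the probability that the absorbing Markov chain with transition matrix $$\mathbf{P}_{out}=\begin{bmatrix}\mathbf{I}_{J\times J}&\mathbf{0}_{J\times n}\\ \mathbf{D}_\eta&\mathbf{B}\end{bmatrix},$$ started in transient state $i$, is eventually absorbed in absorbing state $\hat j$. Then $$\mathbf{M}=(\mathbf{I}-\mathbf{B})^{-1}\mathbf{D}_\eta,$$ and $\mathbf{M}$ is a row stochastic matrix. (ii) $(\mathbf{I}-\mathbf{A}^T)^{-1}\boldsymbol{\delta}=\mathbf{1}$. (iii) If the row sums of $\mathbf{A}^T$ are all equal to $c$, then the input downstreamness $\mathbf{d}=(\mathbf{I}-\mathbf{A}^T)^{-1}\mathbf{1}$ is constant: $\mathbf{d}=\frac{1}{1-c}\mathbf{1}$. If the row sums of $\mathbf{B}$ are all equal to $c$, then the output upstreamness $\mathbf{u}=(\mathbf{I}-\mathbf{B})^{-1}\mathbf{1}$ is constant: $\mathbf{u}=\frac{1}{1-c}\mathbf{1}$.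
   Context: There are $J\ge1$ countries and $S\ge1$ industries, and $n=JS$ country-industry pairs, $V=\{1,\dots,n\}$. The data are a nonnegative $n\times n$ matrix $\mathbf{Z}=[z_{ij}]$ (intermediate sales from pair $i$ to pair $j$) and nonnegative numbers $f_{i\hat j}$, $i\in V$, $\hat j\in\{1,\dots,J\}$ (final use in country $\hat j$ of output from pair $i$). Put $f_i=\sum_{\hat j=1}^J f_{i\hat j}$, gross output $x_i=\sum_j z_{ij}+f_i$, and value added $w_i=x_i-\sum_j z_{ji}$. The adjacency input matrix is $\mathbf{A}=[a_{ij}]$ with $a_{ij}=z_{ij}/x_j$; the adjacency output matrix is $\mathbf{B}=[b_{ij}]$ with $b_{ij}=z_{ij}/x_i$. Further, $\mathbf{D}_\eta=[\eta_{i\hat j}]$ is the $n\times J$ matrix with $\eta_{i\hat j}=f_{i\hat j}/x_i$, and $\boldsymbol{\delta}=[\delta_1,\dots,\delta_n]^T$ with $\delta_i=w_i/x_i$. Standing assumptions: $x_i>0$ and $w_i\ge0$ for all $i$, and $\lambda<1$, where $\lambda$ is the largest (Perron-Frobenius) eigenvalue (spectral radius) of $\mathbf{A}$, equivalently of the similar matrix $\mathbf{B}$. In $\mathbf{P}_{out}$ the first $J$ states are absorbing (one per country) and the remaining $n$ states, identified with $V$, are transient. $\mathbf{1}$ is the all-ones column vector of length $n$. Row stochastic means nonnegative with all row sums equal to $1$. *)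

(* Defs.v *)
From HB Require Import structures.
From mathcomp Require Import all_boot all_order all_algebra.
From mathcomp Require Import complex.
From mathcomp Require Import all_classical all_reals all_analysis.

Set Implicit Arguments.
Unset Strict Implicit.
Unset Printing Implicit Defensive.

Import Order.TTheory GRing.Theory Num.Theory.

Local Open Scope classical_set_scope.
Local Open Scope ring_scope.

(* In the economic definitions, [Z i j] are the intermediate sales from pair [i]
   to pair [j] and [F i j] the final use in country [j] of output from pair
   [i]. *)

Definition final_use (R : realType) (n J : nat) (F : 'M[R]_(n, J)) (i : 'I_n)
  : R := \sum_(j < J) F i j.

Definition gross_output (R : realType) (n J : nat)
    (Z : 'M[R]_n) (F : 'M[R]_(n, J)) (i : 'I_n) : R :=
  \sum_(j < n) Z i j + final_use F i.

Definition value_added (R : realType) (n J : nat)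
    (Z : 'M[R]_n) (F : 'M[R]_(n, J)) (i : 'I_n) : R :=
  gross_output Z F i - \sum_(j < n) Z j i.

Definition input_mx (R : realType) (n J : nat)
    (Z : 'M[R]_n) (F : 'M[R]_(n, J)) : 'M[R]_n :=
  \matrix_(i, j) (Z i j / gross_output Z F j).

Definition output_mx (R : realType) (n J : nat)
    (Z : 'M[R]_n) (F : 'M[R]_(n, J)) : 'M[R]_n :=
  \matrix_(i, j) (Z i j / gross_output Z F i).

Definition final_use_mx (R : realType) (n J : nat)
    (Z : 'M[R]_n) (F : 'M[R]_(n, J)) : 'M[R]_(n, J) :=
  \matrix_(i, j) (F i j / gross_output Z F i).

Definition value_added_coef (R : realType) (n J : nat)
    (Z : 'M[R]_n) (F : 'M[R]_(n, J)) : 'cV[R]_n :=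
  \col_i (value_added Z F i / gross_output Z F i).

Definition input_downstreamness (R : realType) (n J : nat)
    (Z : 'M[R]_n) (F : 'M[R]_(n, J)) : 'cV[R]_n :=
  invmx (1%:M - (input_mx Z F)^T) *m const_mx 1.

Definition output_upstreamness (R : realType) (n J : nat)
    (Z : 'M[R]_n) (F : 'M[R]_(n, J)) : 'cV[R]_n :=
  invmx (1%:M - output_mx Z F) *m const_mx 1.

Definition row_stochastic (R : realType) (m n : nat) (A : 'M[R]_(m, n)) : Prop :=
  (forall i j, 0 <= A i j) /\ (forall i, \sum_j A i j = 1).

(* Eigenvalues are taken over the complex numbers [R[i]]; the norm there is
   [R[i]]-valued with zero imaginary part, hence [complex.Re]. *)
Definition spectral_radius (R : realType) (n : nat) (A : 'M[R]_n) : R :=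
  sup [set complex.Re `|z| | z in
        [set z : R[i] | eigenvalue (map_mx (real_complex R) A) z]].

(* [mc_markov] is the Markov property
     Pr(X_{t+1} = y | X_0 = p 0, ..., X_t = p t) = P (p t) y
   multiplied out, so that conditioning events of probability 0 need no
   special treatment. *)
Record markov_chain (R : realType) (N : nat) (P : 'M[R]_N) (s : 'I_N) :=
  MarkovChain {
    mc_display : measure_display ;
    mc_space : measurableType mc_display ;
    mc_prob : probability mc_space R ;
    mc_state : nat -> mc_space -> 'I_N ;
    mc_measurable : forall t y, measurable [set w | mc_state t w = y] ;
    mc_init : mc_prob [set w | mc_state 0%N w = s] = 1%E ;
    mc_markov : forall (t : nat) (p : nat -> 'I_N) (y : 'I_N),
      mc_prob ([set w | forall k, (k <= t)%N -> mc_state k w = p k]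
               `&` [set w | mc_state t.+1 w = y])
      = (mc_prob [set w | forall k, (k <= t)%N -> mc_state k w = p k]
         * (P (p t) y)%:E)%E
  }.

(* For an absorbing state [a], being eventually absorbed in [a] means visiting
   [a] at some time. *)
Definition absorption_probability (R : realType) (N : nat) (P : 'M[R]_N)
    (s : 'I_N) (X : markov_chain P s) (a : 'I_N) : R :=
  fine (mc_prob X [set w | exists t, mc_state t w = a]).

(* The absorbing state of country [j] is [lshift n j]; the transient state of
   pair [i] is [rshift J i]. *)
Definition P_out (R : realType) (n J : nat)
    (Z : 'M[R]_n) (F : 'M[R]_(n, J)) : 'M[R]_(J + n) :=
  block_mx 1%:M 0 (final_use_mx Z F) (output_mx Z F).

(* [X i] is any realization of the chain started in the transient state [i]. *)
Definition global_final_demand_mx (R : realType) (n J : nat)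
    (Z : 'M[R]_n) (F : 'M[R]_(n, J))
    (X : forall i : 'I_n, markov_chain (P_out Z F) (rshift J i))
  : 'M[R]_(n, J) :=
  \matrix_(i, j) absorption_probability (X i) (lshift n j).

(* Main.v *)
(* Since [lambda < 1], [1] is not an eigenvalue of [A], so [I - A] is invertible,
   and so is [I - B], which is conjugate to it by the diagonal matrix of gross
   outputs. The powers of [P_out] have lower-left block [Q_t], where
   [Q_0 = 0] and [Q_(t+1) = D_eta + B Q_t]. An absorbing state, once visited,
   is almost surely never left, so [Q_t] converges entrywise to [M]; hence
   [M = D_eta + B M], without appealing to [B^t -> 0]. The remaining identities
   come from applying [I - B] and [I - A^T] to the all-ones vector. *)

Require Import Defs.
From HB Require Import structures.
From mathcomp Require Import all_boot all_order all_algebra.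
From mathcomp Require Import complex.
From mathcomp Require Import all_classical all_reals all_analysis.

Set Implicit Arguments.
Unset Strict Implicit.
Unset Printing Implicit Defensive.

Import Order.TTheory GRing.Theory Num.Theory.
Import numFieldNormedType.Exports.

Local Open Scope ring_scope.

(** * Spectral radius and invertibility *)

(** Needed because [sup] bounds its members only when the set is bounded above. Over [R[i]] the
    characteristic polynomial splits, so every eigenvalue is among finitely many roots, and the sum
    of their moduli dominates each modulus. *)
Lemma has_ubound_spectrum (R : realType) (n : nat) (A : 'M[R]_n) :
  has_ubound [set complex.Re `|z| | z in
    [set z : R[i] | eigenvalue (map_mx (real_complex R) A) z]]%classic.
Proof.
set B := map_mx _ A.
have [r pE] := closed_field_poly_normal (char_poly B).
exists (\sum_(z <- r) complex.Re `|z|) => _ [z zB <-].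
have zr : z \in r.
  move: zB; rewrite /mkset eigenvalue_root_char pE (monicP (char_poly_monic B)).
  by rewrite scale1r root_prod_XsubC.
rewrite (big_rem z zr) /= lerDl; apply: sumr_ge0 => w _.
by case: w => a b /=; rewrite sqrtr_ge0.
Qed.

(** By contraposition: a nonzero kernel vector of I - A is fixed by A, so 1 is an eigenvalue and the
    supremum is at least 1. *)
Lemma unitmx_1sub_spectral_radius (R : realType) (n : nat) (A : 'M[R]_n) :
  spectral_radius A < 1 -> 1%:M - A \in unitmx.
Proof.
apply: contraTT => nu; rewrite -leNgt.
apply: (ub_le_sup (has_ubound_spectrum A)).
exists 1; last by rewrite normr1.
rewrite /mkset -(rmorph1 (real_complex R)) eigenvalue_map.
move: nu; rewrite unitmxE unitfE negbK => /det0P[v v0 vA].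
apply/eigenvalueP; exists v => //.
by move/eqP: vA; rewrite mulmxBr mulmx1 subr_eq0 eq_sym scale1r => /eqP.
Qed.

(** * Measures of partitions and of almost increasing unions *)

Lemma measure_finite_partition d (T : measurableType d) (R : realType)
    (mu : {measure set T -> \bar R}) (I : finType) (f : T -> I) (A : set T) :
  measurable A -> (forall i, measurable (f @^-1` [set i])%classic) ->
  mu A = (\sum_i mu (A `&` f @^-1` [set i])%classic)%E.
Proof.
move=> mA mf.
have -> : A = (\bigcup_(i in [set` index_enum I])
    (A `&` f @^-1` [set i]))%classic.
  apply/seteqP; split=> [x Ax|x [i _ [] //]].
  by exists (f x) => //=; rewrite mem_index_enum.
rewrite measure_fin_bigcup //.
- rewrite -fsbig_seq ?index_enum_uniq //; apply: eq_bigr => i _.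
  congr (mu _); apply/seteqP; split=> [x [Ax fx]|x [[j _ [Ax fx]] fi] //].
  by split=> //; exists i => //=; rewrite mem_index_enum.
- by apply: trivIset_preimage1_in.
- by move=> i _; apply: measurableI.
Qed.

(** The partial unions [G t] are truly increasing, have the same union, and exceed [E t] only by a
    null set, so continuity from below applies to them. *)
Lemma measure_bigcup_ae_nondecreasing_cvg d (T : measurableType d)
    (R : realType) (mu : {measure set T -> \bar R}) (E : nat -> set T) :
  (forall t, measurable (E t)) ->
  (forall t, mu (E t `\` E t.+1)%classic = 0%E) ->
  (mu (E t) @[t --> \oo] --> mu (\bigcup_t E t))%classic.
Proof.
move=> mE nullE.
pose G t := (\bigcup_(k in [set k | (k <= t)%N]) E k)%classic.
have mG t : measurable (G t) by apply: bigcup_measurable.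
have nullG t : mu (G t `\` E t)%classic = 0%E.
  elim: t => [|t IH].
    rewrite (_ : (_ `\` _)%classic = set0) ?measure0 //.
    by apply/seteqP; split=> // x [[k /=]]; rewrite leqn0 => /eqP ->.
  (* A point of [G t.+1] outside [E t.+1] either leaves [E t] at this step or already lies in [G t]
     but not in [E t]. *)
  apply: (@subset_measure0 _ _ _ mu _ ((G t `\` E t) `|` (E t `\` E t.+1))%classic).
  - exact: measurableD.
  - by apply: measurableU; apply: measurableD.
  - move=> x [[k /= kt Ekx] nEx].
    have [Etx|nEtx] := pselect (E t x); [by right|left; split=> //].
    move: kt; rewrite leq_eqVlt ltnS => /orP[/eqP kt|kt]; last by exists k.
    by rewrite kt in Ekx.
  - by rewrite -[LHS]/(mu _) measureU0 //; apply: measurableD.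
have GE t : mu (E t) = mu (G t).
  have -> : mu (G t) = (mu (G t `\` E t) + mu (G t `&` E t))%classic%E.
    exact: measureDI.
  rewrite nullG add0e; congr (mu _).
  by apply/seteqP; split=> [x Ex|x [] //]; split=> //; exists t => /=.
have -> : (\bigcup_t E t)%classic = (\bigcup_t G t)%classic.
  apply/seteqP; split=> [x [t _ Ex]|x [t _ [k _ Ex]]]; last by exists k.
  by exists t => //; exists t => /=.
under eq_fun do rewrite GE.
apply: nondecreasing_cvg_mu => //; first exact: bigcup_measurable.
move=> s t st; apply/subsetPset => x [k /= ks Ex].
by exists k => //=; apply: leq_trans st.
Qed.

(** * Finite Markov chains and absorption *)

Section Markov.
Local Open Scope classical_set_scope.
Variables (R : realType) (N : nat) (P : 'M[R]_N) (s : 'I_N).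
Variable X : markov_chain P s.

Let mu := mc_prob X.
Let E (t : nat) (y : 'I_N) := [set w | mc_state (m := X) t w = y].

Let mE t y : measurable (E t y). Proof. exact: mc_measurable. Qed.

(** The Markov property is assumed for full histories only. Both events are cut along the finitely
    many histories up to time [t], and the property is summed over those that end in [x]. *)
Lemma mc_transition t x y :
  mu (E t x `&` E t.+1 y) = (mu (E t x) * (P x y)%:E)%E.
Proof.
pose f w : {ffun 'I_t.+1 -> 'I_N} :=
  [ffun k : 'I_t.+1 => mc_state (m := X) k w].
(* [mc_markov] wants a path on all of [nat]. Beyond [t], [inord] returns a default index, which is
   harmless since only times up to [t] are read. *)
pose path (q : {ffun 'I_t.+1 -> 'I_N}) (k : nat) : 'I_N := q (inord k).
have fE q : f @^-1` [set q] =
    [set w | forall k, (k <= t)%N -> mc_state (m := X) k w = path q k].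
  apply/seteqP; split=> w /=.
    by move=> fw k kt; rewrite /path -fw ffunE inordK.
  move=> H; apply/ffunP => k; rewrite ffunE H -1?ltnS ?ltn_ord //.
  by rewrite /path inord_val.
have mf q : measurable (f @^-1` [set q]).
  rewrite fE (_ : [set w | _] = \bigcap_(k in [set k | (k <= t)%N]) E k (path q k)).
    by apply: bigcap_measurableType.
  by apply/seteqP; split.
have fx (q : {ffun 'I_t.+1 -> 'I_N}) : q ord_max = x -> f @^-1` [set q] `<=` E t x.
  by move=> <- w /= <-; rewrite /E /f ffunE.
have fNx (q : {ffun 'I_t.+1 -> 'I_N}) A : A `<=` E t x -> q ord_max != x ->
    mu (A `&` f @^-1` [set q]) = 0%E.
  move=> Ax /eqP qx; rewrite -(measure0 mu); congr (mu _).
  by apply/seteqP; split=> // w [/Ax Ex] /= fw; apply: qx; rewrite -fw ffunE.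
rewrite (measure_finite_partition mu (measurableI _ _ (mE t x) (mE t.+1 y)) mf).
rewrite (measure_finite_partition mu (mE t x) mf).
rewrite ge0_sume_distrl => [|q _]; last exact: measure_ge0.
(* Histories not ending in [x] contribute 0 to both sides. *)
apply: eq_bigr => q _; have [qx|qx] := eqVneq (q ord_max) x; last first.
  transitivity (0 : \bar R)%E; first by apply: fNx qx => w [].
  by rewrite [X in (X * _)%E](_ : _ = 0%E) ?mul0e //; apply: fNx qx.
rewrite setIAC (_ : E t x `&` _ = f @^-1` [set q]); last exact/setIidr/fx.
rewrite fE; apply: (etrans (mc_markov X t (path q) y)); rewrite -qx.
congr (_ * (P _ _)%:E)%E; rewrite /path; congr (q _).
by apply/val_inj; rewrite /= inordK.
Qed.

Lemma mc_distribution t y : mu (E t y) = ((P ^+ t) s y)%:E.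
Proof.
elim: t y => [|t IH] y.
  rewrite expr0 mxE; have [<-|sy] := eqVneq s y; first exact: mc_init.
  apply: (@subset_measure0 _ _ _ mu _ (~` E 0 s)) => //.
  - exact: measurableC.
  - by move=> w; rewrite /E /= => -> ys; rewrite ys eqxx in sy.
  - apply: (etrans (probability_setC mu (mE 0 s))).
    by rewrite [mu _]mc_init subee.
rewrite (measure_finite_partition mu (mE t.+1 y) (mE t)).
rewrite exprSr mxE -sumEFin; apply: eq_bigr => x _.
by rewrite setIC [LHS]mc_transition IH EFinM.
Qed.

(** With [P a a = 1], staying in [a] for one more step has the same probability as being there, so
    leaving has probability 0 and the events [E t a] increase up to null sets. *)
Lemma absorption_probability_cvg a : P a a = 1 ->
  (P ^+ t) s a @[t --> \oo] --> absorption_probability X a.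
Proof.
move=> Paa.
have nullE t : mu (E t a `\` E t.+1 a) = 0%E.
  have : mu (E t a) = (mu (E t a `\` E t.+1 a) + mu (E t a `&` E t.+1 a))%E.
    exact: measureDI.
  rewrite mc_transition Paa mule1 mc_distribution.
  (* Finiteness permits cancellation in the extended reals. *)
  have /fineK <- : mu (E t a `\` E t.+1 a) \is a fin_num.
    by apply: fin_num_measure; apply: measurableD.
  by case=> /eqP; rewrite -subr_eq subrr => /eqP <-.
have : mu (E t a) @[t --> \oo] --> mu (\bigcup_t E t a).
  exact: measure_bigcup_ae_nondecreasing_cvg.
rewrite -[mu (\bigcup_t _)]fineK; last by apply: fin_num_measure; apply: bigcup_measurable.
move/fine_cvg; rewrite /absorption_probability -/mu.
rewrite (_ : \bigcup_t _ = [set w | exists t, E t a w]); last first.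
  by apply/seteqP; split=> [w [t _ Ew]|w [t Ew]]; exists t.
by under eq_fun do rewrite /= mc_distribution /=.
Qed.

End Markov.

(** Splitting off the first factor of the power, not the last, yields a recursion in which the
    previous block is multiplied by [B]; its limit is a fixed-point equation. *)
Lemma exprS_absorbing_block (R : pzRingType) (m n : nat) (D : 'M[R]_(n, m))
    (B : 'M[R]_n) (t : nat) :
  block_mx 1%:M 0 D B ^+ t
    = block_mx 1%:M 0 (iter t (fun Q => D + B *m Q) 0) (B ^+ t).
Proof.
elim: t => [|t IH]; first by rewrite !expr0 -[1]/(1%:M) scalar_mx_block.
rewrite exprS IH -[LHS]/(_ *m _) mulmx_block /= !mul0mx !mulmx0 mul1mx !mulmx1.
by rewrite !addr0 add0r exprS.
Qed.

(** * Input-output identities and the final demand matrix *)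

Section Leontief.
Variables (R : realType) (n J : nat) (Z : 'M[R]_n) (F : 'M[R]_(n, J)).
Hypothesis hx : forall i, 0 < gross_output Z F i.

Let x_neq0 i : gross_output Z F i != 0. Proof. by rewrite gt_eqF. Qed.

Lemma mulmx_1sub_input_mx_tr_1 :
  (1%:M - (input_mx Z F)^T) *m const_mx 1 = value_added_coef Z F.
Proof.
apply/colP => i; rewrite mulmxBl mul1mx !mxE /value_added mulrBl divff //.
by congr (_ - _); rewrite mulr_suml; apply: eq_bigr => j _; rewrite !mxE mulr1.
Qed.

Lemma mulmx_1sub_output_mx_1 :
  (1%:M - output_mx Z F) *m const_mx 1 = final_use_mx Z F *m const_mx 1 :> 'cV_n.
Proof.
apply/colP => i; rewrite mulmxBl mul1mx !mxE.
under eq_bigr do rewrite !mxE mulr1.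
under [in RHS]eq_bigr do rewrite !mxE mulr1.
rewrite -!mulr_suml -[1](divff (x_neq0 i)) -mulrBl; congr (_ / _).
by rewrite /gross_output addrC addKr.
Qed.

Lemma unitmx_1sub_output_mx :
  1%:M - input_mx Z F \in unitmx -> 1%:M - output_mx Z F \in unitmx.
Proof.
pose x : 'rV[R]_n := \row_i gross_output Z F i.
have xu : diag_mx x \in unitmx.
  rewrite unitmxE det_diag unitfE; apply/prodf_neq0 => i _.
  by rewrite mxE.
(* Scaling the rows of the output matrix, or the columns of the input matrix, by gross output gives
   back [Z]. *)
have xE : diag_mx x *m (1%:M - output_mx Z F)
    = (1%:M - input_mx Z F) *m diag_mx x.
  rewrite mulmxBr mulmxBl mul1mx mulmx1; congr (_ - _).
  apply/matrixP => i j; rewrite mul_diag_mx mul_mx_diag !mxE.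
  by rewrite mulrC !divfK.
have := unitmx_mul (diag_mx x) (1%:M - output_mx Z F).
by rewrite xE unitmx_mul xu andbT => ->.
Qed.

Lemma row_stochastic_P_out :
  (forall i j, 0 <= Z i j) -> (forall i j, 0 <= F i j) ->
  row_stochastic (P_out Z F).
Proof.
move=> hZ hF; split=> [i j|i].
  case: (split_ordP i) => i' ->; case: (split_ordP j) => j' ->.
  - by rewrite block_mxEul mxE ler0n.
  - by rewrite block_mxEur mxE.
  - by rewrite block_mxEdl mxE divr_ge0 // ltW.
  - by rewrite block_mxEdr mxE divr_ge0 // ltW.
rewrite big_split_ord /=; case: (split_ordP i) => i' ->.
  rewrite [X in _ + X]big1 => [|j _]; last by rewrite block_mxEur mxE.
  rewrite addr0 (bigD1 i') //= block_mxEul mxE eqxx big1 ?addr0 // => j ji.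
  by rewrite block_mxEul mxE eq_sym (negPf ji).
under eq_bigr do rewrite block_mxEdl mxE.
under [X in _ + X]eq_bigr do rewrite block_mxEdr mxE.
by rewrite -!mulr_suml -mulrDl addrC -[RHS](divff (x_neq0 i')).
Qed.

Lemma global_final_demand_fixpoint
    (X : forall i : 'I_n, markov_chain (P_out Z F) (rshift J i)) :
  global_final_demand_mx X
    = final_use_mx Z F + output_mx Z F *m global_final_demand_mx X.
Proof.
pose Q t := iter t (fun Q => final_use_mx Z F + output_mx Z F *m Q) 0.
have Qcvg i j : (Q t i j @[t --> \oo] --> global_final_demand_mx X i j)%classic.
  rewrite mxE; have := @absorption_probability_cvg _ _ _ _ (X i) (lshift n j).
  rewrite block_mxEul mxE eqxx => /(_ erefl).
  by under eq_fun do rewrite exprS_absorbing_block block_mxEdl.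
apply/matrixP => i j.
(* The shifted sequence has the limit of the original one; the recursion computes that limit a
   second time. *)
apply: (norm_cvg_unique (F := (Q t.+1 i j @[t --> \oo])%classic)).
  by have := Qcvg i j; rewrite -cvg_shiftS; exact.
have QS t : Q t.+1 i j = final_use_mx Z F i j
    + \sum_k output_mx Z F i k * Q t k j.
  by rewrite [Q _]iterS mxE [X in _ + X]mxE.
rewrite /= mxE [X in _ + X]mxE; under eq_fun do rewrite QS.
apply: cvgD; first exact: cvg_cst.
apply: cvg_big => [|k _]; first exact: add_continuous.
by apply: cvgM; [exact: cvg_cst|exact: Qcvg].
Qed.

Lemma global_final_demandE
    (X : forall i : 'I_n, markov_chain (P_out Z F) (rshift J i)) :
  1%:M - output_mx Z F \in unitmx ->
  global_final_demand_mx X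
    = invmx (1%:M - output_mx Z F) *m final_use_mx Z F.
Proof.
move=> Bu; apply: (canRL (mulKmx Bu)); rewrite mulmxBl mul1mx.
by rewrite {1}global_final_demand_fixpoint addrK.
Qed.

(** Entries are probabilities. For the row sums, D_eta 1 = (I - B) 1, and the inverse of I - B
    cancels. *)
Lemma row_stochastic_global_final_demand
    (X : forall i : 'I_n, markov_chain (P_out Z F) (rshift J i)) :
  1%:M - output_mx Z F \in unitmx -> row_stochastic (global_final_demand_mx X).
Proof.
move=> Bu; split=> [i j|i]; first by rewrite mxE fine_ge0 // measure_ge0.
have /colP/(_ i) : global_final_demand_mx X *m const_mx 1 = const_mx 1 :> 'cV_n.
  by rewrite global_final_demandE // -mulmxA -mulmx_1sub_output_mx_1 mulKmx.
by rewrite !mxE; under eq_bigr do rewrite [X in _ * X]mxE mulr1.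
Qed.

End Leontief.

Lemma invmx_1sub_const_row_sum (R : fieldType) (n : nat) (A : 'M[R]_n) (c : R) :
  1%:M - A \in unitmx -> (forall i, \sum_j A i j = c) ->
  invmx (1%:M - A) *m const_mx 1 = const_mx (1 / (1 - c)) :> 'cV_n.
Proof.
move=> Au Ac.
have A1 : (1%:M - A) *m const_mx 1 = const_mx (1 - c) :> 'cV_n.
  apply/colP => i; rewrite mulmxBl mul1mx !mxE -(Ac i); congr (_ - _).
  by apply: eq_bigr => j _; rewrite mxE mulr1.
apply: (canLR (mulKmx Au)); apply/colP => i.
(* If c were 1, the invertible I - A would kill the all-ones vector, which is nonzero because the
   index [i] exists. *)
have c1 : 1 - c != 0.
  apply/eqP => c1; have /colP/(_ i)/eqP : const_mx 1 = 0 :> 'cV[R]_n.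
    by rewrite -(mulKmx Au (const_mx 1)) A1 c1 mulmx0.
  by rewrite !mxE oner_eq0.
have -> : const_mx (1 / (1 - c)) = (1 / (1 - c)) *: const_mx 1 :> 'cV[R]_n.
  by apply/colP => k; rewrite !mxE mulr1.
by rewrite -scalemxAr A1 !mxE divfK.
Qed.

Theorem theorem3 (R : realType) (J S : nat) (hJ : (1 <= J)%N) (hS : (1 <= S)%N)
    (Z : 'M[R]_(J * S)%N) (F : 'M[R]_((J * S)%N, J))
    (hZ : forall i j, 0 <= Z i j) (hF : forall i j, 0 <= F i j)
    (hx : forall i, 0 < gross_output Z F i)
    (hw : forall i, 0 <= value_added Z F i)
    (hlambda : spectral_radius (input_mx Z F) < 1) :
  [/\ (* (i) *)
      [/\ 1%:M - output_mx Z F \in unitmx,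
          row_stochastic (P_out Z F) &
          forall X : (forall i : 'I_(J * S)%N,
                        markov_chain (P_out Z F) (rshift J i)),
            global_final_demand_mx X
              = invmx (1%:M - output_mx Z F) *m final_use_mx Z F
            /\ row_stochastic (global_final_demand_mx X)],
      (* (ii) *)
      1%:M - (input_mx Z F)^T \in unitmx
      /\ invmx (1%:M - (input_mx Z F)^T) *m value_added_coef Z F = const_mx 1 &
      (* (iii) *)
      (forall c : R, (forall i, \sum_j (input_mx Z F)^T i j = c) ->
         input_downstreamness Z F = const_mx (1 / (1 - c)))
      /\
      (forall c : R, (forall i, \sum_j (output_mx Z F) i j = c) ->
         output_upstreamness Z F = const_mx (1 / (1 - c)))].
Proof.
have Au := unitmx_1sub_spectral_radius hlambda.
have Bu := unitmx_1sub_output_mx hx Au.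
have ATu : 1%:M - (input_mx Z F)^T \in unitmx.
  by rewrite -unitmx_tr linearB /= trmx1 trmxK.
split; split.
- exact: Bu.
- exact: row_stochastic_P_out.
- move=> X; split; first exact: global_final_demandE.
  exact: row_stochastic_global_final_demand.
- exact: ATu.
- by rewrite -mulmx_1sub_input_mx_tr_1 // mulKmx.
- by move=> c; apply: invmx_1sub_const_row_sum.
- by move=> c; apply: invmx_1sub_const_row_sum.
Qed.
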